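(* Let $G$ be a connected, locally finite graph. Then $G$ is transient if and only if $G$ is edge-SIT. If furthermore $G$ has uniformly bounded degree (i.e. there is a constant $d$ with $\deg(v)\le d$ for all vertices $v$), then another equivalent condition is that $G$ is vertex-SIT; that is, in this case the three conditions ''$G$ is transient'', ''$G$ is edge-SIT'' and ''$G$ is vertex-SIT'' are equivalent.
   Context: Graphs are undirected; $u\sim v$ means that $u$ and $v$ are adjacent. $G$ is transient if the simple random walk on $G$ is transient. For a vertex $o$ of $G$, let $\Gamma_o$ be the set of infinite simple paths in $G$ starting at $o$: $\Gamma_o=\{\gamma:\mathbb{N}\to G \text{ injective} : \gamma_0=o,\ \gamma_{n+1}\sim\gamma_n \text{ for all } n\}$ (with $\mathbb{N}=\{0,1,2,\dots\}$). A directed edge $(x,y)$ is in $\gamma$, written $(x,y)\in\gamma$, if there exists $n\in\mathbb{N}$ with $\gamma_n=x$ and $\gamma_{n+1}=y$. A vertex $x$ is in $\gamma$, written $x\in\gamma$, if there exists $n$ with $\gamma_n=x$. For $\alpha,\beta\in\Gamma_o$ define $$|\alpha\cap\beta|_V=\sum_{v\in G}\mathbf{1}_{\{v\in\alpha,\ v\in\beta\}},\qquad |\alpha\cap\beta|_E=\sum_{\substack{u,v\in G\\ u\sim v}}\mathbf{1}_{\{(u,v)\in\alpha,\ (u,v)\in\beta\}},$$ where the second sum is over ordered pairs $(u,v)$, i.e. over directed edges. For a probability measure $\mu$ on $\Gamma_o$, $\mu\otimes\mu$ is the product measure on $\Gamma_o\times\Gamma_o$ (the law of two independent paths of law $\mu$).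 The measure $\mu$ is called vertex-SIT if $\mathbb{E}_{\mu\otimes\mu}|\alpha\cap\beta|_V<\infty$, and edge-SIT if $\mathbb{E}_{\mu\otimes\mu}|\alpha\cap\beta|_E<\infty$. The graph $G$ is called vertex-SIT (resp. edge-SIT) if there exist a vertex $o$ and a vertex-SIT (resp. edge-SIT) probability measure on $\Gamma_o$. *)

(* Defs.v *)
From HB Require Import structures.
From mathcomp Require Import all_boot all_order all_algebra finmap.
From mathcomp Require Import all_classical all_reals all_analysis.

Set Implicit Arguments.
Unset Strict Implicit.
Unset Printing Implicit Defensive.

Import Order.TTheory GRing.Theory Num.Theory.
Local Open Scope classical_set_scope.
Local Open Scope ring_scope.

(* The vertex set is a [pointedType]: graphs are
   nonempty, and MathComp-Analysis only puts sigma-algebras on pointed types.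
   The point plays no other role. *)
Record graph (V : pointedType) := Graph {
  adj : rel V;
  adj_sym : symmetric adj;
  adj_irrefl : irreflexive adj }.

Section Graphs.
Variables (V : pointedType) (G : graph V).

Definition neighbors (x : V) : set V := [set y | adj G x y].

Definition connected_graph : Prop :=
  forall x y : V, exists2 p : seq V, path (adj G) x p & last x p = y.

Definition locally_finite : Prop := forall x : V, finite_set (neighbors x).

(* Only meaningful when [neighbors x] is finite: [fset_set] of an infinite set
   is empty. *)
Definition deg (x : V) : nat := #|` fset_set (neighbors x)|%fset.

Definition bounded_degree : Prop := exists d : nat, forall x : V, (deg x <= d)%N.

End Graphs.

(* Sequences of vertices, with the product over [nat] of the discrete
   sigma-algebras on [V]. *)
Definition coordinate_events (V : pointedType) : set (set (nat -> V)) :=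
  [set B | exists n (A : set V), B = [set w : nat -> V | A (w n)]].

Definition traj (V : pointedType) := g_sigma_algebraType (@coordinate_events V).

Section SimpleRandomWalk.
Variables (R : realType) (V : pointedType) (G : graph V).

(* At an isolated vertex, which a connected graph has only if it is reduced to
   that vertex, the walk stays put, so that this finite graph is recurrent. *)
Definition srw_step (x y : V) : R :=
  if deg G x == 0%N then (x == y)%:R else (adj G x y)%:R / (deg G x)%:R.

Definition srw_law (o : V) (P : probability (traj V) R) : Prop :=
  forall (n : nat) (w : nat -> V),
    P [set x | forall k, (k <= n)%N -> x k = w k] =
    ((w 0%N == o)%:R * \prod_(k < n) srw_step (w k) (w k.+1))%:E.

(* On a connected, locally finite graph, [V] is countable, and [srw_law o]
   holds of exactly one [P]. *)
Definition transient : Prop :=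
  forall o : V, exists2 P : probability (traj V) R,
    srw_law o P & (P [set x | exists2 n, (0 < n)%N & x n = o] < 1)%E.

End SimpleRandomWalk.

Section IntersectionTails.
Variables (R : realType) (V : pointedType) (G : graph V).

Definition simple_rays (o : V) : set (traj V) :=
  [set g | [/\ injective g, g 0%N = o & forall n, adj G (g n.+1) (g n)]].

Definition vertex_in (x : V) (g : traj V) : Prop := exists n, g n = x.

Definition edge_in (e : V * V) (g : traj V) : Prop :=
  exists n, g n = e.1 /\ g n.+1 = e.2.

Definition vertex_meet (a b : traj V) : \bar R :=
  \esum_(v in [set: V]) (\1_[set u | vertex_in u a /\ vertex_in u b] v)%:E.

Definition edge_meet (a b : traj V) : \bar R :=
  \esum_(e in [set e : V * V | adj G e.1 e.2])
    (\1_[set f | edge_in f a /\ edge_in f b] e)%:E.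

(* A probability measure on [simple_rays o] is represented by its image on
   [traj V], that is, by a probability measure carried by [simple_rays o]
   (a measurable set, [V] being countable when [G] is connected and locally
   finite). *)
Definition carried_by_rays (o : V) (mu : probability (traj V) R) : Prop :=
  mu (simple_rays o) = 1%E.

Definition vertex_SIT_measure (o : V) (mu : probability (traj V) R) : Prop :=
  (\int[(mu \x mu)%E]_(p in simple_rays o `*` simple_rays o)
      vertex_meet p.1 p.2 < +oo)%E.

Definition edge_SIT_measure (o : V) (mu : probability (traj V) R) : Prop :=
  (\int[(mu \x mu)%E]_(p in simple_rays o `*` simple_rays o)
      edge_meet p.1 p.2 < +oo)%E.

Definition vertex_SIT : Prop :=
  exists (o : V) (mu : probability (traj V) R),
    carried_by_rays o mu /\ vertex_SIT_measure o mu.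

Definition edge_SIT : Prop :=
  exists (o : V) (mu : probability (traj V) R),
    carried_by_rays o mu /\ edge_SIT_measure o mu.

End IntersectionTails.

(* Main.v *)
(* Write u_n(x) for the probability that the walk from x visits o within n
   steps. It is finitely supported, and summation by parts bounds its Dirichlet
   energy by 2 deg(o) times the probability that the walk from o has not
   returned to o by time n+1.

   If the walk is transient, u = lim u_n has finite energy, is harmonic off o,
   and its positive gradient, suitably normalised, is a unit flow i from o to
   infinity of finite energy. The Markov chain with steps i(x,y) / sum_z i(x,z)
   follows u downwards, hence its paths are simple, and it uses the edge e with
   probability at most i(e); two independent copies share at most sum_e i(e)^2
   edges on average. It visits x with probability at most sum_y i(x,y), so when
   the degrees are at most d the mean number of common vertices is at most d
   times the energy.

   Conversely, if mu is edge-SIT on rays from o', then telescoping along a ray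
   gives u_n(o') <= sum_e mu(e in ray) |du_n(e)|, and by AM-GM the energy of u_n
   is bounded below, as u_n(o') is bounded away from 0 for large n. Thus the
   probability of not having returned to o does not tend to 0. Finally, two
   simple paths share at least as many vertices as directed edges. *)

From HB Require Import structures.
Require Import Defs.
From mathcomp Require Import all_boot all_order all_algebra finmap.
From mathcomp Require Import all_classical all_reals all_analysis.
From mathcomp Require Import measurable_realfun lra.

Set Implicit Arguments.
Unset Strict Implicit.
Unset Printing Implicit Defensive.

Import Order.TTheory GRing.Theory Num.Theory.
Import numFieldNormedType.Exports.
Local Open Scope classical_set_scope.
Local Open Scope ring_scope.

(** * Markov chains on trajectories *)

Definition cyl (V : pointedType) (n : nat) (w : nat -> V) : set (traj V) :=
  [set x | forall k, (k <= n)%N -> x k = w k].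

(** With [p] the step of the simple random walk this unfolds to [srw_law], so the same theory serves
    that walk and the chain that follows the flow. *)
Definition markov_law (R : realType) (V : pointedType) (p : V -> V -> R)
    (o : V) (P : probability (traj V) R) : Prop :=
  forall n w,
    P (cyl n w) = ((w 0%N == o)%:R * \prod_(k < n) p (w k) (w k.+1))%:E.

(** * Realising a Markov chain on one uniform variable *)

Section Construction.
Variables (R : realType) (V : pointedType).

(* Selects the cell of [0, sum q[, cut into consecutive cells of lengths [q y]
   for [y] in [r], that contains [t], and the position of [t] in this cell,
   rescaled to [0, 1[. *)
Fixpoint choose_cell (q : V -> R) (r : seq V) (t : R) : V * R :=
  if r is y :: r' then
    if t < q y then (y, t / q y) else choose_cell q r' (t - q y)
  else (point, t).

Lemma choose_cell_in (q : V -> R) (r : seq V) (t : R) :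
  (forall y, 0 <= q y) -> 0 <= t < \sum_(y <- r) q y ->
  (choose_cell q r t).1 \in r /\ 0 <= (choose_cell q r t).2 < 1.
Proof.
move=> q0; elim: r t => [t|y r ih t]; first by rewrite big_nil => h; lra.
rewrite big_cons /= => /andP[t0 ts]; case: ltP => [tq|qt].
  have q_gt0 : 0 < q y by lra.
  rewrite /= mem_head; split => //.
  by rewrite divr_ge0 //= ltr_pdivrMr // mul1r.
have [|h1 h2] := ih (t - q y); first by lra.
by rewrite inE h1 orbT.
Qed.

(** The constant [c] is the total length of the cells before that of [y]. Rescaling is affine on a
    cell, so an interval of positions pulls back to an interval. *)
Lemma choose_cell_itv (q : V -> R) (r : seq V) (y : V) (a b : R) :
  (forall z, 0 <= q z) -> uniq r -> y \in r -> 0 <= a -> a <= b -> b <= 1 ->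
  exists c, [/\ 0 <= c, c + q y <= \sum_(z <- r) q z &
    forall t, 0 <= t < \sum_(z <- r) q z ->
    ((choose_cell q r t).1 == y) && (a <= (choose_cell q r t).2 < b) =
    (c + q y * a <= t < c + q y * b)].
Proof.
move=> q0 + + a0 ab b1; elim: r => // z r ih /= /andP[zr ur].
have sr : 0 <= \sum_(x <- r) q x by apply: sumr_ge0.
rewrite inE; have [->|yz] /= := eqVneq y z => [_|yr].
  exists 0; split; rewrite ?big_cons ?add0r //; first by rewrite lerDl.
  move=> t /andP[t0 ts]; case: ltP => [tq|qt] /=.
    have q_gt0 : 0 < q z by lra.
    by rewrite eqxx /= ler_pdivlMr // ltr_pdivrMr // ![_ * q z]mulrC ?add0r.
  have [|h _] := @choose_cell_in q r (t - q z) q0; first by lra.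
  case: eqP => [e|_ /=]; first by move: zr; rewrite -e h.
  apply/esym/negbTE; rewrite negb_and -!leNgt ?add0r; apply/orP; right.
  by apply: le_trans qt; rewrite ler_piMr.
have [c [c0 cq hc]] := ih ur yr.
exists (q z + c); split; rewrite ?big_cons.
- by rewrite addr_ge0.
- by rewrite -addrA lerD2l.
move=> t /andP[t0 ts]; case: ltP => [tq|qt] /=.
  rewrite eq_sym (negbTE yz) /=; apply/esym/negbTE.
  rewrite negb_and -ltNge; apply/orP; left; apply: (lt_le_trans tq).
  by rewrite -addrA lerDl addr_ge0 // mulr_ge0.
rewrite hc; last by lra.
by rewrite lerBrDr ltrBlDr ![_ + q z]addrC !addrA.
Qed.

Lemma measurable_choose_cell (q : V -> R) (r : seq V) (F : V -> set R) :
  (forall y, measurable (F y)) ->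
  measurable [set t | F (choose_cell q r t).1 (choose_cell q r t).2].
Proof.
move=> mF; elim: r => [|y r ih] /=; first exact: mF.
rewrite (_ : [set _ | _] =
    ([set` `]-oo, q y[ ] `&` ( *%R^~ (q y)^-1) @^-1` F y) `|`
    ([set` `[q y, +oo[ ] `&` (fun t => t - q y) @^-1`
       [set t | F (choose_cell q r t).1 (choose_cell q r t).2])); last first.
  apply/seteqP; split => t /=; rewrite !in_itv /= andbT.
    by case: ltP => h; [left|right].
  by case: ltP => h [] [].
apply: measurableU; apply: measurableI => //.
  rewrite -[X in measurable X]setTI.
  have mM : measurable_fun setT (fun t : R => t * (q y)^-1).
    exact: mulrr_measurable.
  exact: mM.
rewrite -[X in measurable X]setTI.
have mB : measurable_fun setT (fun t : R => t - q y).
  exact: measurable_funD.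
exact: mB.
Qed.

Variables (p : V -> V -> R) (s : V -> {fset V}).
Hypothesis p_ge0 : forall x y, 0 <= p x y.
Hypothesis p_supp : forall x y, y \notin s x -> p x y = 0.
Hypothesis p_sum : forall x, \sum_(y <- s x) p x y = 1.

(** If [t] is uniform on [[0, 1[], its rescaled position in the selected cell is again uniform and
    independent of the cell, so it can drive the remaining steps. *)
Fixpoint chain_run (n : nat) (x : V) (t : R) : V :=
  if n is m.+1 then
    let c := choose_cell (p x) (s x) t in chain_run m c.1 c.2
  else x.

Lemma measurable_chain_run n x (A : set V) :
  measurable [set t | A (chain_run n x t)].
Proof.
elim: n x => [|n ih] x /=.
  by have [h|h] := pselect (A x);
    [rewrite (_ : [set _ | _] = setT)|rewrite (_ : [set _ | _] = set0)] => //;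
    apply/seteqP; split.
exact: (@measurable_choose_cell (p x) (s x)
  (fun y => [set t | A (chain_run n y t)])).
Qed.

(** By induction on [n]: the interval of the shifted word, started at [w 1], is pulled back into the
    cell of [w 1], which multiplies its length by [p x (w 1)]. *)
Lemma chain_run_itv n (w : nat -> V) x :
  exists ab : R * R, [/\ 0 <= ab.1, ab.1 <= ab.2, ab.2 <= 1,
    ab.2 - ab.1 = (w 0%N == x)%:R * \prod_(k < n) p (w k) (w k.+1) &
    forall t, 0 <= t < 1 ->
    (forall k, (k <= n)%N -> chain_run k x t = w k) <-> ab.1 <= t < ab.2].
Proof.
have triv (m : nat) (v : nat -> V) z : v 0%N != z ->
  exists ab : R * R, [/\ 0 <= ab.1, ab.1 <= ab.2, ab.2 <= 1,
    ab.2 - ab.1 = (v 0%N == z)%:R * \prod_(k < m) p (v k) (v k.+1) &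
    forall t, 0 <= t < 1 ->
    (forall k, (k <= m)%N -> chain_run k z t = v k) <-> ab.1 <= t < ab.2].
  move=> /negbTE h; exists (0, 0); split; rewrite //= ?h ?mul0r ?subr0 //.
  move=> t _; split; last by lra.
  by move/(_ 0%N (leq0n _)) => /= e; rewrite e eqxx in h.
elim: n w x => [|n ih] w x.
  have [e|] := eqVneq (w 0%N) x; last first.
    by move=> h; have := triv 0%N w x h; rewrite (negbTE h).
  exists (0, 1); split; rewrite //= ?e ?big_ord0 ?subr0 ?mulr1 //.
  move=> t ht; split => // _ k; rewrite leqn0 => /eqP ->.
  by rewrite /= e.
have [e|h] := eqVneq (w 0%N) x; last first.
  by have := triv n.+1 w x h; rewrite (negbTE h).
have [[a b] /= [a0 ab b1 hab hrun]] := ih (w \o S) (w 1%N).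
rewrite big_ord_recl /= e mul1r.
have [ws|ws] := boolP (w 1%N \in s x); last first.
  (* Off [s x] the step has probability 0 and is never selected: the interval is empty. *)
  exists (0, 0); split; rewrite //= ?p_supp // ?mul0r ?subr0 //.
  move=> t ht; split; last by lra.
  move/(_ 1%N isT) => /= e1.
  have := @choose_cell_in (p x) (s x) t (p_ge0 x).
  by rewrite p_sum e1 (negbTE ws) => -[].
have [c [c0 cq hc]] :=
  choose_cell_itv (p_ge0 x) (fset_uniq (s x)) ws a0 ab b1.
rewrite p_sum in cq hc.
have pa : p x (w 1%N) * a <= p x (w 1%N) * b by rewrite ler_wpM2l.
have pb : p x (w 1%N) * b <= p x (w 1%N) by rewrite ler_piMr.
exists (c + p x (w 1%N) * a, c + p x (w 1%N) * b); split => /=.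
- by rewrite addr_ge0 // mulr_ge0.
- by rewrite lerD2l.
- by lra.
- move: hab; rewrite eqxx mul1r => hab.
  by under eq_bigr do rewrite /bump /= add1n; rewrite -hab; lra.
move=> t ht; rewrite -hc //.
have [_ h2] := @choose_cell_in (p x) (s x) t (p_ge0 x) ltac:(by rewrite p_sum).
split.
  move=> h; have e1 : (choose_cell (p x) (s x) t).1 = w 1%N := h 1%N isT.
  rewrite e1 eqxx /=; apply/(hrun _ h2) => k kn.
  by have := h k.+1 kn; rewrite /= e1.
move=> /andP[/eqP e1 /(hrun _ h2) h] [|k] kn //=.
by rewrite e1; exact: h.
Qed.

(** [P] is the image of Lebesgue measure on [[0, 1[] under the run from [o]; the mass of a cylinder
    is the length of its interval. *)
Lemma markov_chain_exists o :
  exists P : probability (traj V) R, markov_law p o P.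
Proof.
pose X (t : R) : traj V := fun n => chain_run n o t.
have mX : measurable_fun setT X.
  refine (@measurability _ _ _ _ setT X (@coordinate_events V) erefl _).
  move=> _ [_ [n [A ->]] <-]; rewrite setTI.
  exact: measurable_chain_run.
have mI : measurable [set` `[0 : R, 1[ ] by [].
pose m0 : {measure set (traj V) -> \bar R} :=
  pushforward (mrestr (@lebesgue_measure R) mI) X.
pose m := m0 mX.
have m1 : m setT = 1%E.
  rewrite /m /m0 /= /pushforward /mrestr preimage_setT setTI.
  by rewrite lebesgue_measure_itv /= lte_fin ltr01 oppr0 adde0.
pose PP := Measure_isProbability.Build _ _ _ m m1.
pose P : probability (traj V) R :=
  HB.pack_for (probability (traj V) R) (Measure.sort m) PP.
exists P => n w; rewrite /P /= /m /m0 /= /pushforward /mrestr.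
have [[a b] /= [a0 ab b1 hab hrun]] := chain_run_itv n w o.
rewrite (_ : _ `&` _ = [set` `[a, b[ ]).
  rewrite lebesgue_measure_itv /= lte_fin -hab.
  by case: ltP => [_|ba]; rewrite ?EFinB //; congr (_%:E); lra.
apply/seteqP; split => t /=; rewrite !in_itv /=.
  by move=> [h t01]; apply/(hrun _ t01).
move=> hab'; have t01 : 0 <= t < 1 by lra.
by split => //; apply/(hrun _ t01).
Qed.

End Construction.

(** * Cylinder events *)

Lemma measurable_coordinate (V : pointedType) n (A : set V) :
  measurable [set x : traj V | A (x n)].
Proof. by apply: sub_sigma_algebra; exists n, A. Qed.

Lemma measurable_cyl (V : pointedType) n (w : nat -> V) : measurable (cyl n w).
Proof.
elim: n => [|n ih].
  rewrite (_ : cyl 0 w = [set x : traj V | [set w 0%N] (x 0%N)]).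
    exact: measurable_coordinate.
  apply/seteqP; split => x /= h; first exact: h.
  by move=> k; rewrite leqn0 => /eqP ->.
rewrite (_ : cyl n.+1 w = cyl n w `&` [set x : traj V | [set w n.+1] (x n.+1)]).
  by apply: measurableI => //; exact: measurable_coordinate.
apply/seteqP; split => x /=.
  by move=> h; split => [k kn|]; apply: h => //; exact: leqW.
by move=> [h e] k; rewrite leq_eqVlt ltnS => /orP[/eqP -> //|]; exact: h.
Qed.

Definition extend (V : Type) (m : nat) (w : nat -> V) (y : V) : nat -> V :=
  fun k => if (k <= m)%N then w k else y.

Lemma cyl_extend (V : pointedType) m (w : nat -> V) y :
  cyl m.+1 (extend m w y) = cyl m w `&` [set x | x m.+1 = y].
Proof.
apply/seteqP; split => x /=.
  move=> h; split; last by rewrite h // /extend ltnn.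
  by move=> k km; rewrite h ?(leqW km) // /extend km.
move=> [h e] k; rewrite leq_eqVlt ltnS /extend => /orP[/eqP -> //|km].
  by rewrite ltnn.
by rewrite km; exact: h.
Qed.

(** * First-step analysis: hitting, iterated steps and first return *)

Section MarkovChain.
Variables (R : realType) (V : pointedType).
Variables (p : V -> V -> R) (s : V -> {fset V}).
Hypothesis p_ge0 : forall x y, 0 <= p x y.
Hypothesis p_supp : forall x y, y \notin s x -> p x y = 0.
Hypothesis p_sum : forall x, \sum_(y <- s x) p x y = 1.

(* [hit z n x] is the probability that the chain from [x] visits [z] at one of
   the times 0, ..., n. *)
Fixpoint hit (z : V) (n : nat) (x : V) : R :=
  if x == z then 1
  else if n is m.+1 then \sum_(y <- s x) p x y * hit z m y else 0.

(** The [n]-step transition probabilities. *)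
Fixpoint iter_kernel (n : nat) (x z : V) : R :=
  if n is m.+1 then \sum_(y <- s x) p x y * iter_kernel m y z
  else (x == z)%:R.

Lemma hit_target z n : hit z n z = 1.
Proof. by case: n => [|n] /=; rewrite eqxx. Qed.

Lemma hit_ge0 z n x : 0 <= hit z n x.
Proof.
elim: n x => [|n ih] x /=; case: ifP => // _.
by apply: sumr_ge0 => y _; rewrite mulr_ge0.
Qed.

Lemma hit_le1 z n x : hit z n x <= 1.
Proof.
elim: n x => [|n ih] x /=; case: ifP => // _.
rewrite -(p_sum x); apply: ler_sum => y _.
by rewrite ler_piMr.
Qed.

Lemma hitS z n x : hit z n x <= hit z n.+1 x.
Proof.
elim: n x => [|n ih] x; first by rewrite /=; case: ifP => // _;
  apply: sumr_ge0 => y _; case: ifP => _; rewrite mulr_ge0.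
rewrite [leLHS]/= [leRHS]/=; case: ifP => // _.
by apply: ler_sum => y _; rewrite ler_wpM2l //; exact: ih.
Qed.

Lemma hit_homo z x : {homo hit z ^~ x : m n / (m <= n)%N >-> m <= n}.
Proof. by apply: homo_leq => [n|y u v|n]; [|exact: le_trans|exact: hitS]. Qed.

Lemma sum_eq_supp (r : {fset V}) (F : V -> R) (x : V) :
  (x \notin r -> F x = 0) -> \sum_(y <- r) (x == y)%:R * F y = F x.
Proof.
move=> h; have [xr|xr] := boolP (x \in r).
  rewrite (bigD1_seq x) ?fset_uniq //= eqxx mul1r big1 ?addr0 // => y.
  by rewrite eq_sym => /negbTE ->; rewrite mul0r.
rewrite h // big_seq big1 // => y yr; case: eqP => [e|]; rewrite ?mul0r //.
by rewrite e yr in xr.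
Qed.

Hypothesis s_sym : forall x y, (y \in s x) = (x \in s y).

(** Decomposition at the last step instead of the first. Symmetry of [s] puts every possible
    predecessor of [z] in [s z]. *)
Lemma iter_kernel_recr n x z :
  iter_kernel n.+1 x z = \sum_(y <- s z) iter_kernel n x y * p y z.
Proof.
elim: n x => [|n ih] x.
  rewrite /= (sum_eq_supp (F := fun y => p y z)); last first.
    by rewrite -s_sym => /p_supp.
  under eq_bigr => y _ do rewrite mulrC eq_sym.
  by rewrite (sum_eq_supp (F := p x)) // => /p_supp.
rewrite [LHS]/=.
under eq_bigr => y _ do rewrite -/(iter_kernel n.+1 y z) ih mulr_sumr.
rewrite exchange_big /=; apply: eq_bigr => y _.
by rewrite mulr_suml; apply: eq_bigr => u _; rewrite mulrA.
Qed.

Variables (o : V) (P : probability (traj V) R).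
Hypothesis P_law : markov_law p o P.

Lemma prob_cyl_extend m w y :
  P (cyl m.+1 (extend m w y)) = (P (cyl m w) * (p (w m) y)%:E)%E.
Proof.
rewrite !P_law -EFinM big_ord_recr /= mulrA /extend leqnn ltnn /=.
congr (_ * _ * _)%:E; apply: eq_bigr => k _.
by rewrite ltnW // ltn_ord.
Qed.

Lemma prob_split_coordinate n (r : seq V) (E : set (traj V)) :
  uniq r -> measurable E ->
  P (E `&` [set x | x n \in r]) =
  (\sum_(y <- r) P (E `&` [set x | x n = y]))%E.
Proof.
move=> + mE; elim: r => [|y r ih] /= => [_|/andP[yr ur]].
  by rewrite big_nil (_ : _ `&` _ = set0) ?measure0 // -subset0 => x [].
have mc (A : set V) : measurable (E `&` [set x : traj V | A (x n)]).
  by apply: measurableI => //; exact: measurable_coordinate.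
rewrite big_cons -ih // -measureU //.
- congr (P _); rewrite -setIUr; congr (_ `&` _).
  apply/seteqP; split => x /=; rewrite inE.
    by move=> /orP[/eqP|]; [left|right].
  by move=> [->|->]; rewrite ?eqxx ?orbT.
- exact: (mc [set y]).
- exact: (mc [set` r]).
- by rewrite -subset0 => x /= [[_ e] [_]]; rewrite e (negbTE yr).
Qed.

(** Since the kernel sums to 1 over [s (w m)], the one-step extensions carry the whole mass of the
    cylinder, and what remains of it is null. *)
Lemma prob_cyl_step m w (E : set (traj V)) : measurable E ->
  P (cyl m w `&` E) =
  (\sum_(y <- s (w m)) P (cyl m.+1 (extend m w y) `&` E))%E.
Proof.
move=> mE; have mc := measurable_cyl m w.
pose S := [set x : traj V | x m.+1 \in s (w m)].
have mS : measurable S := measurable_coordinate m.+1 [set` s (w m)].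
have cylS : P (cyl m w `&` S) = P (cyl m w).
  rewrite prob_split_coordinate ?fset_uniq //.
  under eq_bigr => y _ do rewrite -cyl_extend prob_cyl_extend.
  rewrite P_law; under eq_bigr => y _ do rewrite -EFinM.
  by rewrite sumEFin -mulr_sumr p_sum mulr1.
have null : P (cyl m w `\` S) = 0%E.
  have : P (cyl m w) = (P (cyl m w `&` S) + P (cyl m w `\` S))%E.
    by rewrite addeC -measureDI.
  rewrite cylS P_law => /esym/eqP.
  have : P (cyl m w `\` S) \is a fin_num.
    by apply: fin_num_measure; exact: measurableD.
  case: (P _) => // a _; rewrite -EFinD => /eqP[].
  by move=> h; congr (_%:E); lra.
under eq_bigr => y _ do rewrite cyl_extend setIAC.
rewrite -prob_split_coordinate ?fset_uniq //; last exact: measurableI.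
have mCE : measurable (cyl m w `&` E) by exact: measurableI.
rewrite (measureDI P mCE mS) -[RHS]add0e; congr (_ + _)%E.
apply/eqP; rewrite eq_le measure_ge0 andbT -null.
apply: le_measure; rewrite ?inE; [exact: measurableD..|].
by move=> x /= [[? ?] ?].
Qed.

Lemma measurable_hit_between m n z :
  measurable [set x : traj V | exists2 k, (m <= k <= n)%N & x k = z].
Proof.
rewrite (_ : [set _ | _] =
  \bigcup_(k in [set k | (m <= k <= n)%N]) [set x : traj V | [set z] (x k)]).
  by apply: bigcup_measurable => k _; exact: measurable_coordinate.
by apply/seteqP; split => x [k ? ?]; exists k.
Qed.

(** The Markov property for hitting [z]. In the induction the cylinder is lengthened by one step
    while the time window keeps its right end. *)
Lemma prob_cyl_hit z m n w :
  P (cyl m w `&` [set x | exists2 k, (m <= k <= m + n)%N & x k = z]) =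
  (P (cyl m w) * (hit z n (w m))%:E)%E.
Proof.
have at_target i v k : v i = z ->
  P (cyl i v `&` [set x | exists2 j, (i <= j <= i + k)%N & x j = z]) =
  (P (cyl i v) * 1)%E.
  move=> e; rewrite mule1; congr (P _); apply/setIidPl => x /= h.
  by exists i; [rewrite leqnn leq_addr|rewrite h].
elim: n m w => [|n ih] m w /=.
  have [|h] := eqVneq; first exact: at_target.
  rewrite mule0 (_ : _ `&` _ = set0) ?measure0 // -subset0 => x /= [hx [k]].
  by rewrite addn0 -eqn_leq => /eqP <-; rewrite hx // => /eqP; apply/negP.
have [|h] := eqVneq; first exact: at_target.
rewrite prob_cyl_step; last exact: measurable_hit_between.
rewrite P_law -EFinM mulr_sumr -sumEFin; apply: eq_bigr => y _.
have -> : cyl m.+1 (extend m w y) `&`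
    [set x | exists2 k, (m <= k <= m + n.+1)%N & x k = z] =
  cyl m.+1 (extend m w y) `&`
    [set x | exists2 k, (m.+1 <= k <= m.+1 + n)%N & x k = z].
  apply/seteqP; split => x [hx [k hk e]]; split => //; exists k => //.
    rewrite -addSnnS in hk; case/andP: hk => mk ->; rewrite andbT.
    rewrite ltn_neqAle mk andbT; apply/eqP => mk'; move/negP: h; apply.
    by rewrite -e -mk' hx // /extend leqnn.
  by rewrite -addSnnS; case/andP: hk => /ltnW -> ->.
by rewrite ih prob_cyl_extend P_law -!EFinM /extend ltnn !mulrA.
Qed.

Lemma measurable_edge_at n y z :
  measurable [set x : traj V | x n = y /\ x n.+1 = z].
Proof.
rewrite (_ : [set _ | _] = [set x : traj V | [set y] (x n)] `&`
   [set x : traj V | [set z] (x n.+1)]) //.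
by apply: measurableI; exact: measurable_coordinate.
Qed.

Lemma prob_cyl_edge_at m n w y z :
  P (cyl m w `&` [set x | x (m + n)%N = y /\ x (m + n).+1 = z]) =
  (P (cyl m w) * (iter_kernel n (w m) y * p y z)%:E)%E.
Proof.
elim: n m w => [|n ih] m w /=.
  rewrite addn0; have [e|h] := eqVneq (w m) y.
    rewrite mul1r -e -prob_cyl_extend cyl_extend; congr (P _).
    apply/seteqP; split => x /= [hx]; first by case.
    by move=> hz; split => //; split => //; rewrite hx.
  rewrite mul0r mule0 (_ : _ `&` _ = set0) ?measure0 // -subset0.
  by move=> x /= [hx [e _]]; rewrite -e hx // eqxx in h.
rewrite prob_cyl_step; last exact: measurable_edge_at.
rewrite P_law -EFinM mulr_suml mulr_sumr -sumEFin; apply: eq_bigr => u _.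
rewrite addnS -addSn ih prob_cyl_extend P_law -!EFinM /extend ltnn.
by rewrite !mulrA.
Qed.

Lemma prob_start (E : set (traj V)) : measurable E ->
  P E = P (cyl 0 (fun=> o) `&` E).
Proof.
move=> mE; pose C := cyl 0 (fun=> o); have mC : measurable C.
  exact: measurable_cyl.
have PC : P C = 1%E by rewrite P_law big_ord0 eqxx mulr1.
rewrite (measureDI P mE mC) -[RHS]add0e setIC; congr (_ + _)%E.
apply/eqP; rewrite eq_le measure_ge0 andbT.
have -> : 0%E = P (~` C) by rewrite probability_setC // PC subee.
apply: le_measure; rewrite ?inE; [exact: measurableD|exact: measurableC|].
by move=> x [].
Qed.

Lemma prob_edge_at n y z :
  P [set x | x n = y /\ x n.+1 = z] = (iter_kernel n o y * p y z)%:E.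
Proof.
rewrite prob_start; last exact: measurable_edge_at.
have := prob_cyl_edge_at 0 n (fun=> o) y z.
by rewrite add0n => ->; rewrite P_law big_ord0 eqxx mulr1 mul1e.
Qed.

(** [hit o] equals 1 at [o] and cannot see returns. One step is taken first, and the [n] steps left
    make the window run from 1 to [n.+1]. *)
Lemma prob_return n :
  P [set x | exists2 k, (1 <= k <= n.+1)%N & x k = o] =
  (\sum_(y <- s o) p o y * hit o n y)%:E.
Proof.
rewrite prob_start; last exact: measurable_hit_between.
rewrite prob_cyl_step; last exact: measurable_hit_between.
rewrite -sumEFin; apply: eq_bigr => y _.
have := prob_cyl_hit o 1 n (extend 0 (fun=> o) y).
rewrite add1n => ->; rewrite prob_cyl_extend P_law big_ord0 eqxx mulr1 mul1e.
by rewrite -EFinM.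
Qed.

End MarkovChain.

(** * Hitting probabilities and Dirichlet energy *)

Lemma big_subset_seq (R : nmodType) (T : eqType) (r1 r2 : seq T) (F : T -> R) :
  uniq r1 -> uniq r2 -> {subset r1 <= r2} ->
  \sum_(x <- r2 | x \in r1) F x = \sum_(x <- r1) F x.
Proof.
move=> u1 u2 h; rewrite -big_filter; apply/perm_big/uniq_perm => //.
  exact: filter_uniq.
by move=> x; rewrite mem_filter; case: (boolP (x \in r1)) => // /h.
Qed.

Lemma ler_sum_subset (R : numDomainType) (T : eqType) (r1 r2 : seq T)
    (F : T -> R) : uniq r1 -> uniq r2 -> {subset r1 <= r2} ->
  (forall x, 0 <= F x) -> \sum_(x <- r1) F x <= \sum_(x <- r2) F x.
Proof.
move=> u1 u2 h F0; rewrite -(big_subset_seq F u1 u2 h).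
by rewrite [leRHS](bigID [in r1]) /= lerDl sumr_ge0.
Qed.

Section Potential.
Variables (R : realType) (V : pointedType) (G : graph V).
Hypothesis G_lf : locally_finite G.

Definition nb (x : V) : {fset V} := fset_set (neighbors G x).

(** The vertex itself is included because the kernels may stay put: [srw_step] at an isolated
    vertex, and later the chain of the flow. *)
Definition closed_nb (x : V) : {fset V} := (x |` nb x)%fset.

Lemma in_nb x y : (y \in nb x) = adj G x y.
Proof.
rewrite /nb in_fset_set; last exact: G_lf.
by apply/idP/idP; rewrite inE.
Qed.

Lemma in_closed_nb x y : (y \in closed_nb x) = (y == x) || adj G x y.
Proof. by rewrite !inE in_nb. Qed.

Lemma closed_nb_sym x y : (y \in closed_nb x) = (x \in closed_nb y).
Proof. by rewrite !in_closed_nb eq_sym adj_sym. Qed.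

Lemma deg_gt0 x y : adj G x y -> (0 < deg G x)%N.
Proof.
rewrite -in_nb /deg -/(nb x) lt0n => xy; apply/eqP => /cardfs0_eq e.
by rewrite e in_fset0 in xy.
Qed.

Lemma deg_eq0 x y : deg G x = 0%N -> adj G x y = false.
Proof. by move=> d; apply/negP => /deg_gt0; rewrite d. Qed.

Lemma sum_nb_cst x (c : R) : \sum_(y <- nb x) c = (deg G x)%:R * c.
Proof. by rewrite big_const_seq count_predT iter_addr_0 mulr_natl. Qed.

Lemma big_closed_nb x (F : V -> R) :
  \sum_(y <- closed_nb x) F y = F x + \sum_(y <- nb x) F y.
Proof. by rewrite /closed_nb big_fsetU1 //= in_nb adj_irrefl. Qed.

Local Notation step := (@srw_step R V G).

Lemma step_ge0 x y : 0 <= step x y.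
Proof. by rewrite /srw_step; case: ifP => _; rewrite ?divr_ge0. Qed.

Lemma step_supp x y : y \notin closed_nb x -> step x y = 0.
Proof.
rewrite in_closed_nb negb_or => /andP[h1 h2]; rewrite /srw_step.
by rewrite [x == y]eq_sym (negbTE h1) (negbTE h2) mul0r; case: ifP.
Qed.

Lemma step_gt0 x y : adj G x y -> 0 < step x y.
Proof.
move=> xy; have := deg_gt0 xy; rewrite /srw_step lt0n => d.
by rewrite (negbTE d) xy mul1r invr_gt0 ltr0n lt0n.
Qed.

(** With the degree multiplied out, an isolated vertex is no exception: both sides are 0 there. *)
Lemma deg_step x (F : V -> R) :
  (deg G x)%:R * (\sum_(y <- closed_nb x) step x y * F y) =
  \sum_(y <- nb x) F y.
Proof.
rewrite big_closed_nb /srw_step; have [d0|d0] := eqVneq (deg G x) 0%N.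
  rewrite d0 mul0r big_seq big1 // => y.
  by rewrite in_nb deg_eq0.
rewrite adj_irrefl !mul0r add0r mulr_sumr; apply: eq_big_seq => y.
by rewrite in_nb => ->; rewrite mul1r mulVKf // pnatr_eq0.
Qed.

Lemma step_sum x : \sum_(y <- closed_nb x) step x y = 1.
Proof.
have [d0|d0] := eqVneq (deg G x) 0%N.
  rewrite big_closed_nb /srw_step d0 /= eqxx big_seq big1 ?addr0 // => y.
  by rewrite in_nb deg_eq0.
have := deg_step x (fun=> 1); rewrite sum_nb_cst.
under eq_bigr => y _ do rewrite mulr1.
by move/mulfI; apply; rewrite pnatr_eq0.
Qed.

Fixpoint graph_ball (o : V) (n : nat) : {fset V} :=
  if n is m.+1 then (\bigcup_(x <- graph_ball o m) closed_nb x)%fset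
  else [fset o]%fset.

Lemma graph_ball_step o n x y :
  x \in graph_ball o n -> y \in closed_nb x -> y \in graph_ball o n.+1.
Proof. by move=> xn yx; apply/bigfcupP; exists x; rewrite ?xn. Qed.

Lemma graph_ball_last o (q : seq V) :
  path (adj G) o q -> last o q \in graph_ball o (size q).
Proof.
elim/last_ind: q => [|q y ih] /=; first by rewrite inE.
rewrite rcons_path last_rcons size_rcons => /andP[/ih h a].
by apply: graph_ball_step h _; rewrite in_closed_nb a orbT.
Qed.

(** The sum is over ordered pairs, so each undirected edge counts twice. *)
Definition energy (B : {fset V}) (u : V -> R) : R :=
  \sum_(x <- B) \sum_(y <- B) (adj G x y)%:R * (u x - u y) ^+ 2.

(** Summation by parts: the summands at [(x, y)] and [(y, x)] on the right add up to the squared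
    gradient. *)
Lemma energyE B u : energy B u =
  2 * \sum_(x <- B) \sum_(y <- B) (adj G x y)%:R * (u x * (u x - u y)).
Proof.
rewrite mulr_natl mulr2n {2}exchange_big /= -big_split /=.
apply: eq_bigr => x _; rewrite -big_split /=; apply: eq_bigr => y _.
by rewrite (adj_sym G y x) -mulrDr; congr (_ * _); lra.
Qed.

Lemma energy_subset (B C : {fset V}) u : {subset B <= C} ->
  energy B u <= energy C u.
Proof.
move=> BC; have t0 x y : 0 <= (adj G x y)%:R * (u x - u y) ^+ 2.
  by rewrite mulr_ge0 ?sqr_ge0.
apply: (@le_trans _ _
  (\sum_(x <- B) \sum_(y <- C) (adj G x y)%:R * (u x - u y) ^+ 2)).
  by apply: ler_sum => x _; apply: ler_sum_subset.
by apply: ler_sum_subset => // x; apply: sumr_ge0.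
Qed.

Lemma sum_adj (B : {fset V}) x (F : V -> R) : {subset nb x <= B} ->
  \sum_(y <- B) (adj G x y)%:R * F y = \sum_(y <- nb x) F y.
Proof.
move=> h; rewrite -(big_subset_seq F (fset_uniq (nb x)) (fset_uniq B) h).
rewrite [RHS]big_mkcond; apply: eq_bigr => y _.
by rewrite in_nb; case: ifP => _; rewrite ?mul1r ?mul0r.
Qed.

Local Notation hit := (hit step closed_nb).

(** Finite support, which allows summation by parts without boundary terms. *)
Lemma hit_supp o n x : hit o n x != 0 -> x \in graph_ball o n.
Proof.
elim: n x => [|n ih] x /=; first by rewrite inE; case: (x == o); rewrite ?eqxx.
have [-> _|_ h] := eqVneq x o.
  apply: graph_ball_step (ih o _) _; first by rewrite hit_target oner_neq0.
  by rewrite !inE eqxx.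
have [y yx hy] : exists2 y, y \in closed_nb x & hit o n y != 0.
  apply: contrapT => hn; move/eqP: h; apply; rewrite big_seq big1 // => y yx.
  have [->|hy] := eqVneq (hit o n y) 0; first by rewrite mulr0.
  by case: hn; exists y.
by apply: graph_ball_step (ih _ hy) _; rewrite -closed_nb_sym.
Qed.

Lemma hit_gt0 o x (q : seq V) : path (adj G) x q -> last x q = o ->
  0 < hit o (size q) x.
Proof.
elim: q x => [|y q ih] x /=; first by move=> _ ->; rewrite eqxx.
move=> /andP[xy yq] e; case: ifP => // _.
have yx : y \in closed_nb x by rewrite in_closed_nb xy orbT.
rewrite (bigD1_seq y) ?fset_uniq //= ltr_pwDl //.
  by rewrite mulr_gt0 ?step_gt0 ?ih.
apply: sumr_ge0 => z _; rewrite mulr_ge0 ?step_ge0 // hit_ge0 //.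
exact: step_ge0.
Qed.

(** By [prob_return], the probability of a return to [o] between times 1 and [n.+1]. *)
Definition return_within (o : V) (n : nat) : R :=
  \sum_(y <- closed_nb o) step o y * hit o n y.

(** By [energyE], half the energy is the sum of the degree times [u x] times the excess of [u x]
    over its average at [x]. The term at [o] is the bound, and the others are nonpositive. *)
Lemma energy_hit o n B :
  energy B (hit o n) <= 2 * ((deg G o)%:R * (1 - return_within o n)).
Proof.
(* [C] contains the support of [u] and all neighbours of that support. *)
pose C := (B `|` graph_ball o n.+1)%fset; pose u := hit o n.
have BC : {subset B <= C} by move=> x xB; rewrite inE xB.
apply: (le_trans (energy_subset _ BC)); rewrite energyE ler_pM2l //.
have -> : \sum_(x <- C) \sum_(y <- C) (adj G x y)%:R * (u x * (u x - u y)) =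
    \sum_(x <- C) u x * ((deg G x)%:R *
      (u x - \sum_(y <- closed_nb x) step x y * u y)).
  apply: eq_bigr => x _; have [ux|ux] := eqVneq (u x) 0.
    by rewrite ux mul0r big1 // => y _; rewrite mul0r mulr0.
  rewrite sum_adj; last first.
    move=> y; rewrite in_nb => xy; rewrite inE; apply/orP; right.
    by apply: graph_ball_step (hit_supp ux) _; rewrite in_closed_nb xy orbT.
  by rewrite -mulr_sumr mulrBr deg_step sumrB sum_nb_cst.
have oC : o \in C.
  rewrite inE; apply/orP; right; apply: hit_supp.
  by rewrite hit_target oner_neq0.
rewrite (bigD1_seq o) ?fset_uniq //= /u hit_target mul1r gerDl.
apply: sumr_le0 => x xo; apply: mulr_ge0_le0.
  by apply: hit_ge0; exact: step_ge0.
apply: mulr_ge0_le0 => //; rewrite subr_le0.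
(* Off [o], the average of [hit o n] at [x] is [hit o n.+1 x]. *)
apply: (le_trans (hitS _ step_ge0 o n x)); rewrite [leLHS]/=.
by rewrite (negbTE xo).
Qed.

(** At an isolated vertex the walk stays put and so returns surely. *)
Lemma deg_neq0_of_return o n : return_within o n < 1 -> deg G o <> 0%N.
Proof.
move=> + d0; rewrite /return_within big_closed_nb big_seq big1 ?addr0.
  by rewrite /srw_step d0 /= eqxx hit_target mul1r ltxx.
by move=> y; rewrite in_nb deg_eq0.
Qed.

(** Take for [c] the probability of ever returning. *)
Lemma return_within_lt1 o (P : probability (traj V) R) :
  srw_law G o P -> (P [set x | exists2 n, (0 < n)%N & x n = o] < 1)%E ->
  exists2 c : R, c < 1 & forall n, return_within o n <= c.
Proof.
move=> law; set E : set (traj V) := [set x | _]; move=> E1.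
have mE : measurable E.
  rewrite (_ : E = \bigcup_(n in [set n | (0 < n)%N])
    [set x : traj V | [set o] (x n)]).
    by apply: bigcup_measurable => k _; exact: measurable_coordinate.
  by apply/seteqP; split => x [k ? ?]; exists k.
have Efin : P E = (fine (P E))%:E by rewrite fineK // fin_num_measure.
exists (fine (P E)); first by rewrite -lte_fin -Efin.
move=> n; rewrite -lee_fin -Efin.
have := prob_return step_sum (law : markov_law _ _ _) n.
rewrite -/(return_within o n) => <-; apply: le_measure.
- by rewrite inE; exact: measurable_hit_between.
- by rewrite inE.
by move=> x [k /andP[k0 _] xk]; exists k.
Qed.

(** The events of a return by time [n.+1] increase to that of a return at any time, so continuity
    from below preserves the bound. *)
Lemma srw_not_returning o c : c < 1 -> (forall n, return_within o n <= c) ->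
  exists2 P : probability (traj V) R, srw_law G o P &
    (P [set x | exists2 n, (0 < n)%N & x n = o] < 1)%E.
Proof.
move=> c1 hc.
have [P law] := markov_chain_exists step_ge0 step_supp step_sum o.
exists P => //.
pose F n : set (traj V) := [set x | exists2 k, (1 <= k <= n.+1)%N & x k = o].
have EF : [set x : traj V | exists2 n, (0 < n)%N & x n = o] = \bigcup_n F n.
  apply/seteqP; split => x.
    by move=> [k k0 xk]; exists k => //; exists k => //; rewrite k0 ltnW.
  by move=> [n _ [k /andP[k0 _] xk]]; exists k.
have mF n : measurable (F n) by exact: measurable_hit_between.
rewrite EF; apply: (@le_lt_trans _ _ c%:E); last by rewrite lte_fin.
have cvgF : (P \o F) n @[n --> \oo] --> P (\bigcup_n F n).
  apply: nondecreasing_cvg_mu => //; first exact: bigcup_measurable.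
  move=> m n mn; apply/subsetPset => x [k /andP[k0 km] xk]; exists k => //.
  by rewrite k0 (leq_trans km).
rewrite -(cvg_lim _ cvgF) //; apply: lime_le.
  by apply/cvg_ex; eexists; exact: cvgF.
apply: nearW => n /=; rewrite (prob_return step_sum law) lee_fin.
exact: hc.
Qed.

End Potential.

(** * Consequences of connectedness *)

Section Connected.
Variables (R : realType) (V : pointedType) (G : graph V).
Hypotheses (G_lf : locally_finite G) (G_conn : connected_graph G).

(** The balls about [point] are finite and exhaust the graph. *)
Lemma countable_vertices : countable [set: V].
Proof.
have -> : [set: V] = \bigcup_n [set` graph_ball G point n].
  apply/seteqP; split => // x _; have [q pq <-] := G_conn point x.
  by exists (size q) => //=; exact: graph_ball_last.
apply: bigcup_countable => // n _; exact/finite_set_countable/finite_fset.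
Qed.

Lemma hit_pos o x : exists n, 0 < hit (@srw_step R V G) (closed_nb G) o n x.
Proof.
by have [q pq e] := G_conn x o; exists (size q); exact: hit_gt0.
Qed.

End Connected.

(** * The escape flow of a transient walk *)

Lemma cvg_sum_seq (R : realType) (I : Type) (r : seq I) (f : nat -> I -> R)
    (l : I -> R) : (forall i, f n i @[n --> \oo] --> l i) ->
  \sum_(i <- r) f n i @[n --> \oo] --> \sum_(i <- r) l i.
Proof.
by move=> h; apply: cvg_big => [|i _]; [exact: add_continuous|exact: h].
Qed.

(** Reindexing along an injection into [nat] gives a sequence [F'] in which each set is empty or a
    single [F i]. *)
Lemma measure0_bigcup_countable d (X : measurableType d) (R : realType)
    (mu : {measure set X -> \bar R}) (I : Type) (F : I -> set X) :
  countable [set: I] -> (forall i, measurable (F i)) ->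
  (forall i, mu (F i) = 0%E) -> mu (\bigcup_i F i) = 0%E.
Proof.
move=> cI mF F0; have mU := countable_bigcupT_measurable cI mF.
have [g g_inj] := countable_injP _ cI.
apply/measure_negligible => //.
pose F' n := \bigcup_(i in [set i | g i = n]) F i.
apply: (@negligibleS _ _ _ _ (\bigcup_n F' n)).
  by move=> x [i _ Fx]; exists (g i) => //; exists i.
apply: negligible_bigcup => n; have [[i gi]|h] := pselect (exists i, g i = n).
  exists (F i); split => // x [j /= gj].
  by have -> : j = i by apply: g_inj; rewrite ?in_setT ?gj.
apply: (@negligibleS _ _ _ _ set0); last exact: negligible_set0.
by move=> x [i /= gi]; case: h; exists i.
Qed.

(** * Measurability of the set of rays and of passage events *)

Section Measurability.
Variables (V : pointedType) (G : graph V).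
Hypothesis V_countable : countable [set: V].

(** The generating events bear on one coordinate each; a countable union over the value at time [m]
    reduces to them. *)
Lemma measurable_relation m n (r : V -> V -> Prop) :
  measurable [set x : traj V | r (x m) (x n)].
Proof.
rewrite (_ : [set _ | _] = \bigcup_v ([set x : traj V | [set v] (x m)] `&`
    [set x : traj V | [set y | r v y] (x n)])).
  apply: countable_bigcupT_measurable => // v.
  by apply: measurableI; exact: measurable_coordinate.
apply/seteqP; split => x /=; first by move=> h; exists (x m).
by move=> [v _ [-> ]].
Qed.

Lemma measurable_simple_rays o : measurable (simple_rays G o).
Proof.
pose inj := \bigcap_m \bigcap_(n in [set n | n <> m])
  [set x : traj V | x m <> x n].
pose adj' := \bigcap_n [set x : traj V | adj G (x n.+1) (x n)].
rewrite (_ : simple_rays G o =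
    inj `&` [set x : traj V | [set o] (x 0%N)] `&` adj').
  apply: measurableI; last first.
    apply: bigcap_measurableType => n _.
    exact: (measurable_relation n.+1 n (adj G)).
  apply: measurableI; last exact: measurable_coordinate.
  apply: bigcap_measurableType => m _; apply: bigcap_measurableType => n _.
  exact: (measurable_relation m n (fun a b => a <> b)).
apply/seteqP; split => x.
  move=> [xi x0 xa]; split; last by move=> n _; exact: xa.
  by split => // m _ n /= nm /xi /esym.
move=> [[xi x0] xa]; split => // [m n e|n]; last exact: (xa n I).
by apply: contrapT => /nesym mn; exact: (xi m I n mn).
Qed.

Lemma measurable_vertex_in v : measurable [set x : traj V | vertex_in v x].
Proof.
rewrite (_ : [set _ | _] = \bigcup_n [set x : traj V | [set v] (x n)]).
  by apply: bigcup_measurable => n _; exact: measurable_coordinate.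
by apply/seteqP; split => x /= [n] //; exists n.
Qed.

Lemma measurable_edge_in e : measurable [set x : traj V | edge_in e x].
Proof.
rewrite (_ : [set _ | _] =
    \bigcup_n [set x : traj V | x n = e.1 /\ x n.+1 = e.2]).
  by apply: bigcup_measurable => n _; exact: measurable_edge_at.
by apply/seteqP; split => x /= [n] //; exists n.
Qed.

End Measurability.

(** * The limit potential, its unit flow and the chain following it *)

Section EscapeFlow.
Variables (R : realType) (V : pointedType) (G : graph V).
Hypotheses (G_lf : locally_finite G) (G_conn : connected_graph G).
Variables (o : V) (c : R).
Hypotheses (c_lt1 : c < 1) (return_le : forall n, return_within R G o n <= c).

Local Notation step := (@srw_step R V G).
Local Notation nb := (nb G).
Local Notation closed_nb := (closed_nb G).

Definition hit_ever (x : V) : R := limn (fun n => hit step closed_nb o n x).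

Local Notation u := hit_ever.

Lemma cvg_hit_ever x : hit step closed_nb o n x @[n --> \oo] --> u x.
Proof.
apply: nondecreasing_is_cvgn.
  exact: (hit_homo closed_nb (@step_ge0 R V G) o x).
by exists 1 => _ [n _ <-]; apply: hit_le1; [exact: step_ge0|exact: step_sum].
Qed.

Lemma hit_ever_target : u o = 1.
Proof.
apply: cvg_lim => //; under eq_fun do rewrite hit_target.
exact: cvg_cst.
Qed.

Lemma cvg_step_hit_ever x :
  \sum_(y <- closed_nb x) step x y * hit step closed_nb o n y @[n --> \oo] -->
  \sum_(y <- closed_nb x) step x y * u y.
Proof. by apply: cvg_sum_seq => y; apply: cvgMl_tmp; exact: cvg_hit_ever. Qed.

(** The recursion of [hit] passes to the limit, its sums being finite. *)
Lemma hit_ever_harmonic x : x != o -> \sum_(y <- nb x) (u x - u y) = 0.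
Proof.
move=> xo; have ux : u x = \sum_(y <- closed_nb x) step x y * u y.
  apply: cvg_lim => //; rewrite -cvg_shiftS.
  by under eq_fun do rewrite /= (negbTE xo); exact: cvg_step_hit_ever.
by rewrite sumrB sum_nb_cst ux deg_step // subrr.
Qed.

(** The bound of [energy_hit] is uniform in [n], and on a finite [B] the energy passes to the
    limit. *)
Lemma energy_hit_ever B : energy G B u <= 2 * (deg G o)%:R.
Proof.
have h : energy G B (hit step closed_nb o n) @[n --> \oo] --> energy G B u.
  apply: cvg_sum_seq => x; apply: cvg_sum_seq => y; apply: cvgMl_tmp.
  by under eq_fun do rewrite expr2; rewrite expr2;
     apply: cvgM; apply: cvgB; exact: cvg_hit_ever.
rewrite -(cvg_lim _ h) //; apply: limr_le.
  by apply/cvg_ex; eexists; exact: h.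
apply: nearW => n /=; apply: (le_trans (energy_hit _ G_lf o n B)).
rewrite ler_pM2l // ler_piMr // gerBl; apply: sumr_ge0 => y _.
by rewrite mulr_ge0 ?hit_ge0 ?step_ge0 //; exact: step_ge0.
Qed.

(** The total gradient of [u] out of [o], where [u o = 1]: the degree of [o] times the escape
    probability. Dividing by it makes the flow a unit flow. *)
Definition escape_cst : R := \sum_(y <- nb o) (1 - u y).

Local Notation kappa := escape_cst.

Lemma deg_neq0 : deg G o <> 0%N.
Proof. exact: (deg_neq0_of_return G_lf (le_lt_trans (return_le 0) c_lt1)). Qed.

Lemma escape_cst_gt0 : 0 < kappa.
Proof.
rewrite /kappa sumrB sum_nb_cst -deg_step // -mulrBr mulr_gt0 //.
  by rewrite ltr0n lt0n; apply/eqP; exact: deg_neq0.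
rewrite subr_gt0; apply: le_lt_trans c_lt1.
have h := @cvg_step_hit_ever o; rewrite -(cvg_lim _ h) //.
apply: limr_le; first by apply/cvg_ex; eexists; exact: h.
by apply: nearW => n; exact: return_le.
Qed.

(** The positive part orients each edge downhill for [u], so that flow never runs both ways along an
    edge. *)
Definition flow (x y : V) : R :=
  if adj G x y then Num.max 0 (u x - u y) / kappa else 0.

Definition outflow (x : V) : R := \sum_(y <- nb x) flow x y.

Definition inflow (x : V) : R := \sum_(y <- nb x) flow y x.

Lemma flow_ge0 x y : 0 <= flow x y.
Proof.
rewrite /flow; case: ifP => // _; rewrite divr_ge0 ?le_max ?lexx //.
exact/ltW/escape_cst_gt0.
Qed.

Lemma flow_gt0 x y : (0 < flow x y) = adj G x y && (u y < u x).
Proof.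
rewrite /flow; case: ifP => _ /=; last by rewrite ltxx.
by rewrite pmulr_lgt0 ?invr_gt0 ?escape_cst_gt0 // lt_max ltxx subr_gt0.
Qed.

Lemma outflow_ge0 x : 0 <= outflow x.
Proof. by apply: sumr_ge0 => y _; exact: flow_ge0. Qed.

Lemma inflow_ge0 x : 0 <= inflow x.
Proof. by apply: sumr_ge0 => y _; exact: flow_ge0. Qed.

(** A real number is the difference of its positive and negative parts, so the net outflow is the
    total gradient at [x] over [kappa]: 0 off [o] by harmonicity, 1 at [o]. *)
Lemma flow_conservation x : outflow x = inflow x + (x == o)%:R.
Proof.
have k0 := escape_cst_gt0.
apply/eqP; rewrite addrC -subr_eq; apply/eqP.
have -> : outflow x - inflow x = (\sum_(y <- nb x) (u x - u y)) / kappa.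
  rewrite /outflow /inflow -sumrB mulr_suml; apply: eq_big_seq => y.
  rewrite in_nb // => xy; rewrite /flow xy adj_sym xy -mulrBl; congr (_ / _).
  by rewrite /Num.max; case: ltP => a; case: ltP => b; lra.
have [->|xo] := eqVneq x o; last by rewrite hit_ever_harmonic // mul0r.
by rewrite hit_ever_target -/kappa divff // gt_eqF.
Qed.

Lemma flow_le_inflow x y : flow x y <= inflow y.
Proof.
have [xy|] := boolP (adj G x y); last first.
  by move=> /negbTE xy; rewrite /flow xy inflow_ge0.
rewrite /inflow (bigD1_seq x) ?fset_uniq ?in_nb 1?adj_sym //= lerDl.
by apply: sumr_ge0 => z _; exact: flow_ge0.
Qed.

Lemma sum_flow_sqr (B : {fset V}) :
  \sum_(x <- B) \sum_(y <- B) flow x y ^+ 2 <= 2 * (deg G o)%:R / kappa ^+ 2.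
Proof.
have k0 : 0 <= (kappa ^+ 2)^-1 by rewrite invr_ge0 sqr_ge0.
apply: (@le_trans _ _ (energy G B u / kappa ^+ 2)); last first.
  by rewrite ler_wpM2r // energy_hit_ever.
rewrite /energy mulr_suml; apply: ler_sum => x _.
rewrite mulr_suml; apply: ler_sum => y _.
rewrite /flow; case: ifP => _; last by rewrite expr0n !mul0r.
rewrite expr_div_n mul1r ler_wpM2r // /Num.max.
by case: ltP => _ //; rewrite expr0n /= sqr_ge0.
Qed.

(** Where no flow leaves, the chain stays put, which keeps the kernel stochastic. *)
Definition flow_kernel (x y : V) : R :=
  if outflow x == 0 then (x == y)%:R else flow x y / outflow x.

Local Notation q := flow_kernel.

Lemma flow_kernel_ge0 x y : 0 <= q x y.
Proof.
rewrite /q; case: ifP => // _.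
by rewrite divr_ge0 ?flow_ge0 ?outflow_ge0.
Qed.

Lemma flow_kernel_supp x y : y \notin closed_nb x -> q x y = 0.
Proof.
rewrite in_closed_nb // negb_or => /andP[h1 h2]; rewrite /q /flow.
by rewrite [x == y]eq_sym (negbTE h1) (negbTE h2) mul0r; case: ifP.
Qed.

Lemma flow_kernel_sum x : \sum_(y <- closed_nb x) q x y = 1.
Proof.
rewrite big_closed_nb // /q; have [d0|d0] := eqVneq (outflow x) 0.
  rewrite eqxx big_seq big1 ?addr0 // => y.
  by rewrite in_nb //; case: eqP => // ->; rewrite adj_irrefl.
by rewrite /flow adj_irrefl mul0r add0r -mulr_suml divff.
Qed.

Lemma outflow_kernel x y : outflow x * q x y <= flow x y.
Proof.
rewrite /q; have [->|d0] := eqVneq (outflow x) 0.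
  by rewrite mul0r flow_ge0.
by rewrite mulrC divfK.
Qed.

Local Notation iter_q := (iter_kernel q closed_nb).

(** The left side is the mean number of visits to [x] before time [n]. Time 0 contributes 1 at [o];
    by induction, later arrivals from [y] number at most [outflow y * q y x], hence at most
    [flow y x]. Conservation closes the induction. *)
Lemma occupation_le_outflow n x : \sum_(k < n) iter_q k o x <= outflow x.
Proof.
elim: n x => [|n ih] x; first by rewrite big_ord0 outflow_ge0.
rewrite big_ord_recl flow_conservation addrC [iter_q _ _ _]/= eq_sym lerD2r.
under eq_bigr => k _ do
  rewrite lift0 (iter_kernel_recr flow_kernel_supp (closed_nb_sym G_lf)).
rewrite exchange_big /= big_closed_nb // /inflow -[leRHS]add0r; apply: lerD.
  (* The term [y = x] is nonpositive, because [flow x x = 0]. *)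
  rewrite -mulr_suml; apply: (@le_trans _ _ (outflow x * q x x)).
    by rewrite ler_wpM2r ?flow_kernel_ge0.
  by apply: (le_trans (outflow_kernel x x)); rewrite /flow adj_irrefl.
apply: ler_sum => y _; rewrite -mulr_suml; apply: le_trans (outflow_kernel y x).
by rewrite ler_wpM2r ?flow_kernel_ge0.
Qed.

Variable P : probability (traj V) R.
Hypothesis P_law : markov_law q o P.

(** A union bound over the crossing time, with the expected visits to [e.1] bounded by its
    outflow. *)
Lemma prob_edge_in_le e : (P [set x | edge_in e x] <= (flow e.1 e.2)%:E)%E.
Proof.
pose F n : set (traj V) := [set x | x n = e.1 /\ x n.+1 = e.2].
have sub : [set x : traj V | edge_in e x] `<=` \bigcup_n F n.
  by move=> x [n h]; exists n.
apply: (le_trans (measure_sigma_subadditive P _ _ sub)).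
- by move=> n; exact: measurable_edge_at.
- exact: measurable_edge_in.
apply: lime_le; first exact: is_cvg_nneseries.
apply: nearW => n.
have PF k : P (F k) = (iter_q k o e.1 * q e.1 e.2)%:E.
  exact: (prob_edge_at flow_kernel_sum P_law).
rewrite (eq_bigr _ (fun k _ => PF k)).
rewrite sumEFin lee_fin -mulr_suml; apply: le_trans (outflow_kernel _ _).
by rewrite ler_wpM2r ?flow_kernel_ge0 // big_mkord occupation_le_outflow.
Qed.

(** Almost surely the chain starts at [o] and makes only steps of positive probability. Along such a
    trajectory every step carries positive flow, so [u] strictly decreases and no vertex recurs. *)
Lemma flow_walk_carried : carried_by_rays G o P.
Proof.
have cV := countable_vertices G_lf G_conn.
(* Making a given forbidden step at a given time: a countable family of null events. *)
pose bad (i : nat * (V * V)) : set (traj V) :=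
  if q i.2.1 i.2.2 == 0 then
    [set x | x i.1 = i.2.1 /\ x i.1.+1 = i.2.2] else set0.
have mbad i : measurable (bad i).
  by rewrite /bad; case: ifP => _ //; exact: measurable_edge_at.
have bad0 i : P (bad i) = 0%E.
  rewrite /bad; case: eqP => [q0|_]; last exact: measure0.
  by rewrite (prob_edge_at flow_kernel_sum P_law) q0 mulr0.
have cI : countable [set: nat * (V * V)].
  by rewrite -!setXTT; apply: countableX => //; exact: countableX.
have mB := countable_bigcupT_measurable cI mbad.
have B0 := measure0_bigcup_countable cI mbad bad0.
have mS := measurable_simple_rays G cV o.
pose C : set (traj V) := cyl 0 (fun=> o).
have mC : measurable C by exact: measurable_cyl.
have PC : P C = 1%E by rewrite P_law big_ord0 eqxx mulr1.
have sub : C `\` \bigcup_i bad i `<=` simple_rays G o.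
  move=> x [Cx Bx]; have x0 : x 0%N = o by rewrite Cx.
  have qx n : q (x n) (x n.+1) != 0.
    apply/eqP => qn; apply: Bx; exists (n, (x n, x n.+1)) => //.
    by rewrite /bad /= qn eqxx.
  have out_gt0 n : 0 < outflow (x n) /\ 0 < flow (x n) (x n.+1).
    have next m : 0 < outflow (x m) -> 0 < flow (x m) (x m.+1).
      move=> h; rewrite lt_neqAle flow_ge0 andbT eq_sym.
      by apply/eqP => f0; have := qx m; rewrite /q (gt_eqF h) f0 mul0r eqxx.
    (* By conservation, [o] has outflow at least 1, and a vertex entered with positive flow has
       positive outflow. *)
    have out m : 0 < outflow (x m).
      elim: m => [|m ih].
        by rewrite x0 flow_conservation eqxx ltr_wpDl ?inflow_ge0.
      rewrite flow_conservation ltr_pwDl // (lt_le_trans (next m ih)) //.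
      exact: flow_le_inflow.
    by split; [|exact: next].
  have dec m n : (m < n)%N -> u (x n) < u (x m).
    elim: n => // n ih; rewrite ltnS leq_eqVlt => /orP[/eqP ->|/ih h].
      by have [_] := out_gt0 n; rewrite flow_gt0 => /andP[].
    by apply: lt_trans h; have [_] := out_gt0 n; rewrite flow_gt0 => /andP[].
  split => // [m n e|n].
    by case: (ltngtP m n) => // /dec; rewrite e ltxx.
  by have [_] := out_gt0 n; rewrite flow_gt0 adj_sym => /andP[].
rewrite /carried_by_rays; apply/eqP; rewrite eq_le probability_le1 //=.
rewrite -PC (measureDI P mC mB) [X in (_ + X)%E](_ : _ = 0%E) ?adde0.
  by apply: le_measure; rewrite ?inE //; exact: measurableD.
apply/eqP; rewrite eq_le measure_ge0 andbT -B0.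
by apply: le_measure; rewrite ?inE //; exact: measurableI.
Qed.

End EscapeFlow.

(** * Mean intersections of two independent paths *)

Lemma esum_le_fset (R : realType) (T : choiceType) (I : set T)
    (a : T -> \bar R) (M : \bar R) :
  (forall F : {fset T}, [set` F] `<=` I -> (\sum_(i <- F) a i <= M)%E) ->
  (\esum_(i in I) a i <= M)%E.
Proof.
move=> h; apply: ge_ereal_sup => _ [X [finX XI] <-].
rewrite fsbig_finite //=; apply: h => i /=.
by rewrite in_fset_set // inE => /XI.
Qed.

Lemma fset_le_esum (R : realType) (T : choiceType) (I : set T)
    (a : T -> \bar R) (F : {fset T}) :
  [set` F] `<=` I -> (\sum_(i <- F) a i <= \esum_(i in I) a i)%E.
Proof.
move=> FI; apply: esum_ge; exists [set` F]; first by split.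
by rewrite fsbig_finite //= set_fsetK.
Qed.

(** * Exchanging integrals and countable unordered sums *)

Section IntegralEsum.
Variables (R : realType) (T : pointedType) (g : T -> nat).
Hypothesis g_inj : injective g.
Variable I : set T.

Let ginv (n : nat) : T := xget point [set i | g i = n].

Let ginvK i : ginv (g i) = i.
Proof.
by apply: g_inj; apply: (xgetPex point (P := [set j | g j = g i])); exists i.
Qed.

(** Transport along [g], with 0 outside the image of [I], turns the unordered sum into a series over
    [nat], to which monotone convergence applies. *)
Let extend0 (a : T -> \bar R) (n : nat) : \bar R :=
  if n \in g @` I then a (ginv n) else 0%E.

Lemma esum_nneseries (a : T -> \bar R) : (forall i, 0 <= a i)%E ->
  (\esum_(i in I) a i = \sum_(n <oo) extend0 a n)%E.
Proof.
move=> a0; rewrite nneseries_esumT; last first.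
  by move=> n; rewrite /extend0; case: ifP.
rewrite -esum_mkcond (reindex_esum I (g @` I) g); last first.
  by apply: inj_bij => i j _ _ /g_inj.
by apply: eq_esum => i _; rewrite ginvK.
Qed.

Variables (d : measure_display) (X : measurableType d).
Variables (mu : {measure set X -> \bar R}) (D : set X).
Variable f : T -> X -> \bar R.
Hypothesis mD : measurable D.
Hypothesis mf : forall i, measurable_fun D (f i).
Hypothesis f_ge0 : forall i x, (0 <= f i x)%E.

Let extend0_fun n x : \bar R := extend0 (f ^~ x) n.

Let extend0_fun_ge0 n x : (0 <= extend0_fun n x)%E.
Proof. by rewrite /extend0_fun /extend0; case: ifP. Qed.

Let mextend0_fun n : measurable_fun D (extend0_fun n).
Proof.
rewrite /extend0_fun /extend0; case: (n \in g @` I); first exact: mf.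
exact: measurable_cst.
Qed.

Lemma ge0_measurable_esum :
  measurable_fun D (fun x => \esum_(i in I) f i x)%E.
Proof.
rewrite (_ : (fun x => _) = (fun x => \sum_(n <oo) extend0_fun n x)%E).
  by apply: ge0_emeasurable_sum => // n x _ _; exact: extend0_fun_ge0.
by apply/funext => x; rewrite esum_nneseries.
Qed.

Lemma ge0_integral_esum :
  (\int[mu]_(x in D) (\esum_(i in I) f i x) =
   \esum_(i in I) \int[mu]_(x in D) f i x)%E.
Proof.
rewrite esum_nneseries; last by move=> i; apply: integral_ge0.
under eq_integral do rewrite esum_nneseries //.
rewrite (integral_nneseries mu mD mextend0_fun) //; apply: eq_eseriesr => n _.
rewrite /extend0_fun /extend0; case: (n \in g @` I) => //.
by rewrite integral0.
Qed.

End IntegralEsum.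

(** * Independence: mean intersections as sums of squared probabilities *)

Section Meetings.
Variables (R : realType) (V : pointedType) (mu : probability (traj V) R).
Variables (T : pointedType) (I : set T) (A : T -> traj V -> Prop).
Variable S : set (traj V).
Hypothesis T_countable : countable [set: T].
Hypothesis mA : forall i, measurable [set x | A i x].
Hypothesis mS : measurable S.

Local Notation meet a b :=
  (\esum_(i in I) (\1_[set u | A u a /\ A u b] i)%:E)%E.

Let meetE (p : traj V * traj V) i : \1_[set u | A u p.1 /\ A u p.2] i =
  \1_([set x | A i x] `*` [set x | A i x]) p :> R.
Proof.
by rewrite !indicE.
Qed.

Let mAA i : measurable ([set x | A i x] `*` [set x | A i x]).
Proof. by apply: measurableX. Qed.

Let mSS : measurable (S `*` S).
Proof. by apply: measurableX. Qed.

Let m1 i : measurable_fun (S `*` S) (fun p : traj V * traj V =>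
  (\1_[set u | A u p.1 /\ A u p.2] i : R)%:E).
Proof.
rewrite (_ : (fun p => _) =
    (fun p => (\1_([set x | A i x] `*` [set x | A i x]) p)%:E)).
  by apply/measurable_EFinP/measurable_funTS; exact: measurable_indic.
by apply/funext => p; rewrite meetE.
Qed.

Let ind_ge0 i (p : traj V * traj V) :
  (0 <= (\1_[set u | A u p.1 /\ A u p.2] i : R)%:E)%E.
Proof. by rewrite lee_fin indicE. Qed.

Lemma measurable_meet :
  measurable_fun (S `*` S) (fun p : traj V * traj V => meet p.1 p.2 : \bar R).
Proof.
have [g g_inj] := countable_injP _ T_countable.
have gi : injective g by move=> i j; apply: g_inj; rewrite inE.
exact: (ge0_measurable_esum gi).
Qed.

(** The indicator that both paths satisfy [A i] is that of a rectangle, whose product measure is a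
    square. [A] is generic so as to cover both vertices and edges. *)
Lemma integral_meet :
  (\int[(mu \x mu)%E]_(p in S `*` S) (meet p.1 p.2) =
   \esum_(i in I)
     (mu ([set x | A i x] `&` S) * mu ([set x | A i x] `&` S)))%E.
Proof.
have [g g_inj] := countable_injP _ T_countable.
have gi : injective g by move=> i j; apply: g_inj; rewrite inE.
rewrite (ge0_integral_esum gi) //; apply: eq_esum => i _.
under eq_integral do rewrite meetE.
rewrite integral_indic //.
rewrite (_ : _ `&` _ = ([set x | A i x] `&` S) `*` ([set x | A i x] `&` S)).
  by apply: product_measure1E; exact: measurableI.
by apply/seteqP; split => -[x y] /= [[? ?] [? ?]].
Qed.

End Meetings.

(** Cauchy-Schwarz, from AM-GM applied to each product [f x * f y]. *)
Lemma sqr_sum_le (R : realFieldType) (T : Type) (r : seq T) (f : T -> R) :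
  (\sum_(y <- r) f y) ^+ 2 <= (size r)%:R * \sum_(y <- r) f y ^+ 2.
Proof.
have -> : (size r)%:R * \sum_(y <- r) f y ^+ 2 =
    \sum_(x <- r) \sum_(y <- r) (f x ^+ 2 + f y ^+ 2) / 2.
  under [RHS]eq_bigr => x _ do rewrite -mulr_suml big_split /= big_const_seq
    count_predT iter_addr_0.
  rewrite -mulr_suml big_split /= sumrMnl big_const_seq count_predT iter_addr_0.
  by rewrite mulr_natl; lra.
rewrite expr2 mulr_suml; apply: ler_sum => x _.
rewrite mulr_sumr; apply: ler_sum => y _.
by have := sqr_ge0 (f x - f y); rewrite ler_pdivlMr // => h; nra.
Qed.

Lemma double_sum_seq (R : nmodType) (T : Type) (r r' : seq T) (F : T * T -> R) :
  \sum_(e <- [seq (x, y) | x <- r, y <- r']) F e =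
  \sum_(x <- r) \sum_(y <- r') F (x, y).
Proof. by rewrite big_allpairs_dep. Qed.

(** * Comparing edges with vertices, and gradients along rays *)

Section Intersections.
Variables (R : realType) (V : pointedType) (G : graph V).
Hypotheses (G_lf : locally_finite G) (G_conn : connected_graph G).

Let cV : countable [set: V] := countable_vertices G_lf G_conn.

Let cVV : countable [set: V * V].
Proof. by rewrite -setXTT; exact: countableX. Qed.

Let mV (v : V) : measurable [set x : traj V | vertex_in v x].
Proof. exact: measurable_vertex_in. Qed.

Let mE (e : V * V) : measurable [set x : traj V | edge_in e x].
Proof. exact: measurable_edge_in. Qed.

Let mS o : measurable (simple_rays G o).
Proof. exact: measurable_simple_rays. Qed.

(** Sending a common directed edge to its origin is injective, since the simple path [a] leaves a
    vertex only once. *)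
Lemma edge_meet_le_vertex_meet o (a b : traj V) : simple_rays G o a ->
  (edge_meet R G a b <= vertex_meet R a b)%E.
Proof.
move=> [a_inj _ _]; apply: esum_le_fset => F _.
pose F' := [seq e <- F | `[< edge_in e a /\ edge_in e b >]].
have inF' e : e \in F' -> edge_in e a /\ edge_in e b.
  by rewrite mem_filter => /andP[/asboolP].
pose W := [fset v in [seq e.1 | e <- F']]%fset.
apply: (@le_trans _ _ (\sum_(v <- W)
    (\1_[set u | vertex_in u a /\ vertex_in u b] v : R)%:E)%E); last first.
  exact: fset_le_esum.
have uF' : uniq [seq e.1 | e <- F'].
  rewrite map_inj_in_uniq ?filter_uniq ?fset_uniq //.
  move=> [x y] [z t] /inF'[[n [/= n1 n2]] _] /inF'[[m [/= m1 m2]] _] xz.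
  have nm : n = m by apply: a_inj; rewrite n1 m1.
  by rewrite -n2 -m2 nm xz.
rewrite (perm_big [seq e.1 | e <- F']) /=; last first.
  by apply: uniq_perm; rewrite ?fset_uniq // => v; rewrite !inE.
rewrite big_map big_filter [leRHS]big_mkcond; apply: lee_sum => e _.
rewrite !indicE; case: asboolP => [[[n [n1 n2]] [m [m1 m2]]]|h].
  rewrite !mem_set //=; first by split; [exists n|exists m].
  by split; [exists n|exists m].
by rewrite memNset.
Qed.

Lemma vertex_SIT_edge_SIT : vertex_SIT R G -> edge_SIT R G.
Proof.
case=> o [P] [P_rays P_sit]; exists o, P; split => //.
apply: le_lt_trans P_sit; apply: ge0_le_integral => //=.
- exact: measurableX.
- by move=> p _; apply: esum_ge0 => e _; rewrite lee_fin indicE.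
- exact: measurable_meet.
- exact: measurable_meet.
by move=> [a b] /= [ha _]; exact: (edge_meet_le_vertex_meet _ ha).
Qed.

Lemma ray_leaves o (g : traj V) (K : {fset V}) : simple_rays G o g ->
  exists n, g n \notin K.
Proof.
move=> [g_inj _ _]; apply: contrapT => h.
have gK n : g n \in K by apply: contrapT => /negP ?; apply: h; exists n.
have : (size (map g (iota 0 (size K).+1)) <= size K)%N.
  apply: uniq_leq_size; first by rewrite map_inj_uniq ?iota_uniq.
  by move=> x /mapP[n _ ->].
by rewrite size_map size_iota ltnn.
Qed.

(* Telescoping along the ray until it leaves the support of [u]. *)
Lemma ray_gradient o (g : traj V) (K B : {fset V}) (u : V -> R) :
  simple_rays G o g -> (forall x, u x != 0 -> x \in K) ->
  (forall x y, x \in K -> y \in closed_nb G x -> y \in B) ->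
  u o <= \sum_(e <- [seq (x, y) | x <- B, y <- B])
    (adj G e.1 e.2)%:R * `|u e.1 - u e.2| * \1_[set x | edge_in e x] g.
Proof.
move=> hg uK KB; have [g_inj g0 g_adj] := hg.
case: (ex_minnP (ray_leaves K hg)) => N gN Nmin.
have gK n : (n < N)%N -> g n \in K.
  by move=> nN; apply: contraTT nN => /Nmin; rewrite -leqNgt.
have uN : u (g N) = 0 by apply: contraNeq gN; exact: uK.
have -> : u o = \sum_(0 <= n < N) (u (g n) - u (g n.+1)).
  have := telescope_sumr (u \o g) (leq0n N); rewrite /= uN g0 sub0r => h.
  by rewrite -[LHS]opprK -h -sumrN; apply: eq_bigr => n _; rewrite opprB.
pose F e := (adj G e.1 e.2)%:R * `|u e.1 - u e.2| *
  (\1_[set x : traj V | edge_in e x] g : R).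
pose r := [seq (g n, g n.+1) | n <- iota 0 N].
apply: (@le_trans _ _ (\sum_(e <- r) F e)).
  rewrite big_map /index_iota subn0; apply: ler_sum => n _.
  rewrite /F /= adj_sym g_adj mul1r indicE mem_set; last by exists n.
  by rewrite mulr1 ler_norm.
(* The edges of a simple ray are distinct, so the sum along the ray is part of the sum over all
   pairs. *)
apply: ler_sum_subset.
- by rewrite map_inj_uniq ?iota_uniq // => m n [/g_inj].
- by apply: allpairs_uniq; rewrite ?fset_uniq // => -[? ?] [? ?] _ _.
- move=> e /mapP[n]; rewrite mem_iota /= => /gK nK ->.
  apply/allpairsP; exists (g n, g n.+1); split => //=.
    by apply: (KB (g n)) => //; rewrite in_closed_nb // eqxx.
  by apply: (KB (g n)) => //; rewrite in_closed_nb // adj_sym g_adj orbT.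
by move=> e; rewrite /F indicE !mulr_ge0.
Qed.

(** * Lower bound on the energy of a finitely supported function *)

Section Energy.
Variables (o : V) (mu : probability (traj V) R).
Hypothesis mu_rays : carried_by_rays G o mu.

Definition edge_prob (e : V * V) : R :=
  fine (mu ([set x | edge_in e x] `&` simple_rays G o)).

Let mES e : measurable ([set x | edge_in e x] `&` simple_rays G o).
Proof. exact: measurableI. Qed.

Lemma edge_probE e :
  mu ([set x | edge_in e x] `&` simple_rays G o) = (edge_prob e)%:E.
Proof. by rewrite fineK // fin_num_measure. Qed.

(** Integrates [ray_gradient] over the rays; its left side is constant and [mu] has mass 1 there. *)
Lemma mean_gradient (K B : {fset V}) (u : V -> R) : 0 <= u o ->
  (forall x, u x != 0 -> x \in K) ->
  (forall x y, x \in K -> y \in closed_nb G x -> y \in B) ->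
  u o <= \sum_(x <- B) \sum_(y <- B)
    (adj G x y)%:R * `|u x - u y| * edge_prob (x, y).
Proof.
move=> u0 uK KB; rewrite -(double_sum_seq B B (fun e =>
  (adj G e.1 e.2)%:R * `|u e.1 - u e.2| * edge_prob e)).
have w0 e : 0 <= (adj G e.1 e.2)%:R * `|u e.1 - u e.2| by rewrite mulr_ge0.
have int_u : (\int[mu]_(x in simple_rays G o) (u o)%:E = (u o)%:E)%E.
  rewrite integral_cst // -[RHS]mule1; congr (_ * _)%E; exact: mu_rays.
have -> : (u o <= \sum_(e <- [seq (x, y) | x <- B, y <- B])
    (adj G e.1 e.2)%:R * `|u e.1 - u e.2| * edge_prob e) =
  ((\int[mu]_(x in simple_rays G o) (u o)%:E <=
    \int[mu]_(x in simple_rays G o) (\sum_(e <- [seq (x, y) | x <- B, y <- B])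
    ((adj G e.1 e.2)%:R * `|u e.1 - u e.2|)%:E *
    (\1_[set x | edge_in e x] x)%:E))%E).
  rewrite int_u ge0_integral_sum //.
  - rewrite -lee_fin -sumEFin; congr (_ <= _)%E; apply: eq_bigr => e _.
    rewrite ge0_integralZl_EFin //.
    + by rewrite EFinM -edge_probE integral_indic.
    + by apply/measurable_EFinP/measurable_funTS; exact: measurable_indic.
  - move=> e; apply: emeasurable_funM => //.
    by apply/measurable_EFinP/measurable_funTS; exact: measurable_indic.
apply: ge0_le_integral => //.
- apply: emeasurable_sum => e; apply: emeasurable_funM => //.
  by apply/measurable_EFinP/measurable_funTS; exact: measurable_indic.
move=> x hx; under eq_bigr => e _ do rewrite -EFinM.
by rewrite sumEFin lee_fin; exact: (ray_gradient hx uK KB).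
Qed.

(** AM-GM on each edge, in the form [2 * (b * a) <= t * a ^+ 2 + b ^+ 2 / t]; the weight [t] is left
    free. *)
Lemma mean_gradient_energy (K B : {fset V}) (u : V -> R) (C t : R) :
  0 < t -> 0 <= u o -> (forall x, u x != 0 -> x \in K) ->
  (forall x y, x \in K -> y \in closed_nb G x -> y \in B) ->
  \sum_(x <- B) \sum_(y <- B) (adj G x y)%:R * edge_prob (x, y) ^+ 2 <= C ->
  2 * u o <= t * C + energy G B u / t.
Proof.
move=> t0 u0 uK KB hC; have := mean_gradient u0 uK KB.
move=> h; apply: (@le_trans _ _ (2 * \sum_(x <- B) \sum_(y <- B)
    (adj G x y)%:R * `|u x - u y| * edge_prob (x, y))).
  by rewrite ler_pM2l.
apply: (@le_trans _ _ (t * (\sum_(x <- B) \sum_(y <- B)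
    (adj G x y)%:R * edge_prob (x, y) ^+ 2) + energy G B u / t)); last first.
  by rewrite lerD2r ler_pM2l.
rewrite !mulr_sumr mulr_suml -big_split /=; apply: ler_sum => x _.
rewrite !mulr_sumr mulr_suml -big_split /=; apply: ler_sum => y _.
case: (adj G x y); last by rewrite !mul0r !mulr0 addr0.
rewrite !mul1r -[(u x - u y) ^+ 2]real_normK ?num_real //.
set a := edge_prob _; set b := `|_|.
have : 0 <= (t * a - b) ^+ 2 / t by rewrite divr_ge0 ?sqr_ge0 // ltW.
have -> : (t * a - b) ^+ 2 / t = t * a ^+ 2 - 2 * (b * a) + b ^+ 2 / t.
  have tt : t / t = 1 by rewrite divff // gt_eqF.
  rewrite sqrrB mulrDl mulrBl exprMn !expr2 -mulr_natr.
  have -> : t * t * (a * a) / t = t / t * (t * (a * a)) by lra.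
  have -> : t * a * b * 2 / t = t / t * (2 * (b * a)) by lra.
  by rewrite tt !mul1r.
lra.
Qed.

End Energy.

(** * From edge-SIT to transience *)

Lemma edge_SIT_transient : edge_SIT R G -> transient R G.
Proof.
case=> o' [mu] [mu_rays] + o.
rewrite /edge_SIT_measure (integral_meet mu _ cVV mE (mS o')) => sit.
set M := esum _ _ in sit.
have M0 : (0 <= M)%E by apply: esum_ge0 => e _; rewrite mule_ge0.
pose C := fine M; have MC : M = C%:E by rewrite fineK // ge0_fin_numE.
have C0 : 0 <= C by exact: fine_ge0.
(* These are partial sums of the mean number of common edges. *)
have hC (B : {fset V}) : \sum_(x <- B) \sum_(y <- B)
    (adj G x y)%:R * edge_prob o' mu (x, y) ^+ 2 <= C.
  rewrite -(double_sum_seq B B (fun e =>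
    (adj G e.1 e.2)%:R * edge_prob o' mu e ^+ 2)).
  pose F := [fset e in [seq (x, y) | x <- B, y <- B] | adj G e.1 e.2]%fset.
  have -> : \sum_(e <- [seq (x, y) | x <- B, y <- B])
      (adj G e.1 e.2)%:R * edge_prob o' mu e ^+ 2 =
      \sum_(e <- F) edge_prob o' mu e ^+ 2.
    rewrite -(big_subset_seq (r1 := F) (r2 := [seq (x, y) | x <- B, y <- B])).
    - rewrite [RHS]big_mkcond; apply: eq_big_seq => e he.
      by rewrite !inE /= he; case: adj; rewrite ?mul1r ?mul0r.
    - exact: fset_uniq.
    - by apply: allpairs_uniq; rewrite ?fset_uniq // => -[? ?] [? ?] _ _.
    - by move=> e; rewrite !inE => /andP[].
  have FI : [set` F] `<=` [set e | adj G e.1 e.2].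
    by move=> e /=; rewrite !inE => /andP[].
  rewrite -lee_fin -MC -sumEFin; apply: le_trans (fset_le_esum _ FI).
  by apply: lee_sum => e _; rewrite edge_probE -EFinM expr2.
(* The rays start at [o'] while returns to an arbitrary [o] are studied; connectedness links the
   two. *)
have [N0 h0] := hit_pos R G_lf G_conn o o'.
set hit' := hit (@srw_step R V G) (closed_nb G) o in h0.
(* This [t] gives [t * C <= del], so from [2 * del <= t * C + E / t] the energy [E] is at least
   [del * t]. Adding 1 avoids dividing by zero. *)
pose del := hit' N0 o'; pose t := del / (C + 1).
have t0 : 0 < t by rewrite divr_gt0 // ltr_wpDl.
have hn n : (N0 <= n)%N ->
  del * t <= 2 * ((deg G o)%:R * (1 - return_within R G o n)).
  move=> N0n; pose K := graph_ball G o n; pose B := graph_ball G o n.+1.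
  have KB x y : x \in K -> y \in closed_nb G x -> y \in B.
    exact: graph_ball_step.
  have un : del <= hit' n o'.
    exact: (hit_homo _ (@step_ge0 R V G) o o' N0n).
  have un0 : 0 <= hit' n o' by apply: hit_ge0; exact: step_ge0.
  have := mean_gradient_energy mu_rays t0 un0
    (@hit_supp R V G G_lf o n) KB (hC B).
  have := energy_hit R G_lf o n B; rewrite -/hit'.
  set E := energy _ _ _ => hE h.
  have tC : t * C <= del.
    rewrite /t mulrAC ler_pdivrMr ?ltr_wpDl // ler_wpM2l ?lerDl //.
    exact: ltW.
  apply: le_trans hE; rewrite -ler_pdivlMr //; lra.
have dt0 : 0 < del * t by rewrite mulr_gt0.
have deg0 : 0 < (deg G o)%:R :> R.
  rewrite lt_neqAle ler0n andbT; apply/eqP => d0.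
  by have := hn N0 (leqnn _); rewrite -d0 mul0r mulr0 leNgt dt0.
(* The bound [hn], solved for [return_within]. *)
pose c := 1 - del * t / (2 * (deg G o)%:R).
apply: (@srw_not_returning R V G G_lf o c).
  by rewrite /c gtrBl divr_gt0 // mulr_gt0.
(* For [n] below [N0], monotonicity in time reduces to a later [n']. *)
move=> n; have [n' [nn' N0n']] : exists n', (n <= n')%N /\ (N0 <= n')%N.
  by exists (maxn n N0); rewrite leq_maxl leq_maxr.
apply: (@le_trans _ _ (return_within R G o n')).
  apply: ler_sum => y _; rewrite ler_wpM2l ?step_ge0 //.
  exact: (hit_homo _ (@step_ge0 R V G) o y nn').
have := hn _ N0n'; rewrite mulrA -ler_pdivrMl ?mulr_gt0 // /c mulrC; lra.
Qed.

(** * From transience to edge-SIT and vertex-SIT *)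

(** All that both SIT conclusions need: a law on rays whose edge probabilities are dominated by a
    square-summable function. *)
Lemma transient_flow_measure : transient R G ->
  exists (o : V) (mu : probability (traj V) R) (f : V -> V -> R) (M : R),
  [/\ carried_by_rays G o mu,
      forall x y, 0 <= f x y,
      forall e, (mu [set x | edge_in e x] <= (f e.1 e.2)%:E)%E &
      forall B : {fset V}, \sum_(x <- B) \sum_(y <- B) f x y ^+ 2 <= M].
Proof.
move=> /(_ point)[P law ret]; have [c c1 hc] := return_within_lt1 G_lf law ret.
have [mu mu_law] := markov_chain_exists
  (flow_kernel_ge0 G_lf c1 hc) (flow_kernel_supp R G_lf point)
  (flow_kernel_sum R G_lf point) point.
exists point, mu, (flow R G point),
  (2 * (deg G point)%:R / escape_cst R G point ^+ 2).
split.
- exact: (flow_walk_carried G_lf G_conn c1 hc mu_law).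
- exact: (flow_ge0 G_lf c1 hc).
- exact: (prob_edge_in_le G_lf c1 hc mu_law).
- exact: sum_flow_sqr.
Qed.

Lemma sqr_prob_le (mu : probability (traj V) R) (A S : set (traj V)) (r : R) :
  measurable A -> measurable S -> (mu (A `&` S) <= r%:E)%E ->
  (mu (A `&` S) * mu (A `&` S) <= (r ^+ 2)%:E)%E.
Proof. by move=> mA mS' h; rewrite expr2 EFinM lee_pmul. Qed.

Lemma transient_edge_SIT : transient R G -> edge_SIT R G.
Proof.
case/transient_flow_measure => o [mu] [f] [M] [mu_rays f0 hf hM].
exists o, mu; split => //.
rewrite /edge_SIT_measure (integral_meet mu _ cVV mE (mS o)).
apply: (@le_lt_trans _ _ M%:E); last exact: ltry.
apply: esum_le_fset => F _.
(* All endpoints of edges of [F], so that [F] lies in the square of [B]. *)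
pose B := ([fset e.1 | e in F] `|` [fset e.2 | e in F])%fset.
apply: (@le_trans _ _ (\sum_(e <- F) (f e.1 e.2 ^+ 2)%:E)%E).
  apply: lee_sum => e _; apply: sqr_prob_le => //.
  apply: le_trans (hf e); apply: le_measure; rewrite ?inE //.
  exact: measurableI.
rewrite sumEFin lee_fin; apply: le_trans (hM B).
rewrite -(double_sum_seq B B (fun e => f e.1 e.2 ^+ 2)).
apply: ler_sum_subset => [||e eF|e]; rewrite ?fset_uniq ?sqr_ge0 //.
  by apply: allpairs_uniq; rewrite ?fset_uniq // => -[? ?] [? ?] _ _.
apply/allpairsP; exists e; split; last by case: (e).
  by rewrite inE; apply/orP; left; apply/imfsetP; exists e.
by rewrite inE; apply/orP; right; apply/imfsetP; exists e.
Qed.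

(** A ray through [v] leaves [v] along some edge, so its probability is at most a sum of at most [d]
    values of [f]. Cauchy-Schwarz bounds the square by [d] times the sum of squares. *)
Lemma transient_vertex_SIT :
  bounded_degree G -> transient R G -> vertex_SIT R G.
Proof.
case=> d hd; case/transient_flow_measure => o [mu] [f] [M] [mu_rays f0 hf hM].
exists o, mu; split => //.
rewrite /vertex_SIT_measure (integral_meet mu _ cV mV (mS o)).
apply: (@le_lt_trans _ _ (d%:R * M)%:E); last exact: ltry.
apply: esum_le_fset => F _.
pose out x := \sum_(y <- nb G x) f x y.
have prob_out v :
  (mu ([set x | vertex_in v x] `&` simple_rays G o) <= (out v)%:E)%E.
  have sub : [set x | vertex_in v x] `&` simple_rays G o `<=`
      \big[setU/set0]_(y <- nb G v) [set x : traj V | edge_in (v, y) x].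
    move=> x [[n xn] [_ _ xa]].
    rewrite -bigcup_seq; exists (x n.+1); last by exists n.
    by rewrite /= in_nb // -xn adj_sym xa.
  apply: (@le_trans _ _ (mu (\big[setU/set0]_(y <- nb G v)
      [set x : traj V | edge_in (v, y) x]))).
    apply: le_measure; rewrite ?inE //; first exact: measurableI.
    exact: bigsetU_measurable.
  rewrite /out -sumEFin.
  elim: (enum_fset (nb G v)) => [|y r ih]; first by rewrite !big_nil measure0.
  rewrite !big_cons; apply: (le_trans (measureU2 _ _ _)) => //.
    exact: bigsetU_measurable.
  by apply: leeD => //; exact: (hf (v, y)).
apply: (@le_trans _ _ (\sum_(v <- F) (out v ^+ 2)%:E)%E).
  by apply: lee_sum => v _; exact: sqr_prob_le.
rewrite sumEFin lee_fin.
pose B := (F `|` \bigcup_(x <- F) nb G x)%fset.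
apply: (@le_trans _ _ (d%:R * \sum_(x <- B) \sum_(y <- B) f x y ^+ 2));
  last first.
  by rewrite ler_wpM2l.
rewrite mulr_sumr; apply: (@le_trans _ _
    (\sum_(x <- F) d%:R * \sum_(y <- B) f x y ^+ 2)).
  rewrite big_seq [leRHS]big_seq; apply: ler_sum => x xF.
  apply: (le_trans (sqr_sum_le _ _)); apply: ler_pM => //.
  - by apply: sumr_ge0 => y _; rewrite sqr_ge0.
  - by rewrite ler_nat; exact: hd.
  apply: ler_sum_subset => [||y yx|y]; rewrite ?fset_uniq ?sqr_ge0 //.
  by rewrite inE; apply/orP; right; apply/bigfcupP; exists x; rewrite ?xF.
apply: ler_sum_subset => [||x xF|x]; rewrite ?fset_uniq //.
  by rewrite inE xF.
by rewrite mulr_ge0 // sumr_ge0 // => y _; rewrite sqr_ge0.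
Qed.

End Intersections.

Theorem theorem3 (R : realType) (V : pointedType) (G : graph V) :
  connected_graph G -> locally_finite G ->
  (transient R G <-> edge_SIT R G) /\
  (bounded_degree G ->
    (transient R G <-> edge_SIT R G) /\
    (transient R G <-> vertex_SIT R G) /\
    (edge_SIT R G <-> vertex_SIT R G)).
Proof.
move=> G_conn G_lf.
have te : transient R G <-> edge_SIT R G.
  by split; [exact: transient_edge_SIT|exact: edge_SIT_transient].
split => // bd.
have ve : vertex_SIT R G -> edge_SIT R G by exact: vertex_SIT_edge_SIT.
have tv : transient R G -> vertex_SIT R G by exact: transient_vertex_SIT.
tauto.
Qed.
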